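(* Let $F$ and $t$ be positive integers such that $F+t$ is even and $F+t\le 2F$. Let $S$ be a numerical semigroup. Then $S$ is an almost symmetric numerical semigroup with Frobenius number $F$ and type $t$ if and only if there exist $S'\in\mathscr{B}(F,t)$ and a subset $A$ of $\mathrm{msg}(S')$ of cardinality $\lceil t/2\rceil-1$ such that $S=S'\setminus A$, $\mathrm{F}(S')/2<x<\mathrm{F}(S')$ for every $x\in A$, and $x+y-\mathrm{F}(S')\notin S'\setminus A$ for every $x,y\in A$.
   Context: $\mathbb{N}$ denotes the nonnegative integers. A numerical semigroup is a subset $S\subseteq\mathbb{N}$ closed under addition, containing $0$, with $\mathbb{N}\setminus S$ finite. $\mathrm{msg}(S)$ denotes the unique minimal system of generators of $S$ (which is finite). The Frobenius number $\mathrm{F}(S)$ is the largest integer not in $S$. A pseudo-Frobenius number of $S$ is an integer $x\in\mathbb{Z}\setminus S$ with $x+s\in S$ for all $s\in S\setminus\{0\}$; the set of these is $\mathrm{PF}(S)$, and the type of $S$ is $\mathrm{t}(S)=\#\mathrm{PF}(S)$. Let $\mathrm{L}(S)=\{x\in\mathbb{N}\setminus S\mid \mathrm{F}(S)-x\notin S\}$ (gaps of the second type). $S$ is almost symmetric if $\mathrm{L}(S)\subseteq\mathrm{PF}(S)$. A numerical semigroup is irreducible if it is not the intersection of two numerical semigroups properly containing it; $\mathscr{I}(F)$ is the set of all irreducible numerical semigroups with Frobenius number $F$. For a numerical semigroup $S$, $b(S)$ is the cardinality of $\{x\in\mathrm{msg}(S)\mid \mathrm{F}(S)/2<x<\mathrm{F}(S)\}$,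 and $\mathscr{B}(F,t)=\{S'\in\mathscr{I}(F)\mid b(S')\ge\lceil t/2\rceil-1\}$, where $\lceil\cdot\rceil$ is the ceiling function. *)

(* Defs.v *)
From HB Require Import structures.
From mathcomp Require Import all_boot all_order all_algebra.
From mathcomp Require Import finmap all_classical.

Set Implicit Arguments.
Unset Strict Implicit.
Unset Printing Implicit Defensive.

Import Order.TTheory GRing.Theory Num.Theory.
Local Open Scope ring_scope.
Local Open Scope classical_set_scope.

Definition submonoid (S : set nat) : Prop :=
  S 0%N /\ forall x y : nat, S x -> S y -> S (x + y)%N.

Definition numerical_semigroup (S : set nat) : Prop :=
  submonoid S /\ finite_set (~` S).

(* S regarded as a set of integers. *)
Definition zset (S : set nat) : set int := [set n%:Z | n in S].

Definition gen (A : set nat) : set nat := smallest submonoid A.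

Definition minimal_generators (S A : set nat) : Prop :=
  gen A = S /\ forall B : set nat, B `<` A -> gen B <> S.

(* A submonoid of nat has exactly one minimal system of generators, so the
   default value set0 is not used for numerical semigroups. *)
Definition msg (S : set nat) : set nat := xget set0 (minimal_generators S).

(* The largest integer outside S, which is -1 when S is all of nat; the default
   value 0 is not used for numerical semigroups. *)
Definition frobenius (S : set nat) : int :=
  xget 0 [set f : int | ~ zset S f /\ forall z : int, ~ zset S z -> z <= f].

Definition pseudo_frobenius (S : set nat) : set int :=
  [set x : int | ~ zset S x /\
     forall s : nat, S s -> s <> 0%N -> zset S (x + s%:Z)].

(* The cardinality of fset_set X is that of X when X is finite (and 0
   otherwise).  PF(S) is finite for a numerical semigroup S: it lies between
   - s and F(S) for any nonzero s in S. *)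
Definition semigroup_type (S : set nat) : nat :=
  #|` fset_set (pseudo_frobenius S)|.

Definition second_gaps (S : set nat) : set nat :=
  [set x : nat | ~ S x /\ ~ zset S (frobenius S - x%:Z)].

Definition almost_symmetric (S : set nat) : Prop :=
  numerical_semigroup S /\ zset (second_gaps S) `<=` pseudo_frobenius S.

Definition irreducible_semigroup (S : set nat) : Prop :=
  numerical_semigroup S /\
  ~ exists S1 S2 : set nat,
      [/\ numerical_semigroup S1, numerical_semigroup S2,
          S `<` S1, S `<` S2 & S = S1 `&` S2].

Definition irreducibles (F : nat) : set (set nat) :=
  [set S | irreducible_semigroup S /\ frobenius S = F%:Z].

(* F(S)/2 < x < F(S), the half being taken in the rationals. *)
Definition in_upper_half (S : set nat) (x : nat) : Prop :=
  (frobenius S)%:Q / 2 < x%:Q /\ x%:Z < frobenius S.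

(* The set counted is finite, being bounded by F(S). *)
Definition b (S : set nat) : nat :=
  #|` fset_set [set x | msg S x /\ in_upper_half S x]|.

(* uphalf t is the ceiling of t/2; the predecessor is an honest subtraction
   for t > 0. *)
Definition scrB (F t : nat) : set (set nat) :=
  [set S | irreducibles F S /\ ((uphalf t).-1 <= b S)%N].

(* Main.v *)
(* Write L for the second-type gaps of S and U for those above F/2.  Since
   PF(S) is contained in L together with F, almost symmetry means that
   PF(S) consists of L and F; as L is stable under x |-> F - x, this gives
   t(S) = 2 #U + [F even] + 1.  An almost symmetric S becomes irreducible when
   U is adjoined, and the elements of U are then generators.  Conversely,
   deleting from an irreducible S' a set A of generators above F/2 makes
   U = A, and the condition on x + y - F is what puts L into PF(S). *)
Require Import Defs.
From mathcomp Require Import all_boot all_order all_algebra.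
From mathcomp Require Import finmap all_classical.
From mathcomp Require Import zify.

Import Order.TTheory GRing.Theory Num.Theory.
Local Open Scope ring_scope.
Local Open Scope classical_set_scope.

(** * The Frobenius number in terms of natural numbers *)

Lemma zset_nat (S : set nat) (n : nat) : zset S n%:Z <-> S n.
Proof. by split=> [[m Sm [<-]]|Sn]; last exists n. Qed.

Definition has_frobenius (F : nat) (S : set nat) : Prop :=
  ~ S F /\ forall n : nat, (F < n)%N -> S n.

Lemma frobeniusP (F : nat) (S : set nat) :
  (0 < F)%N -> frobenius S = F%:Z <-> has_frobenius F S.
Proof.
move=> F_gt0; split.
- rewrite /frobenius; case: xgetP => [f fE [nSf maxf] fF|_ []]; last first.
    (* The default value 0 of [xget] is excluded by [0 < F]. *)
    by move=> F0; rewrite -F0 in F_gt0.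
  move: nSf maxf; rewrite fF => nSF maxF; split; first by move=> /zset_nat.
  move=> n ltFn; apply: contrapT => nSn.
  have /maxF : ~ zset S n%:Z by move=> /zset_nat.
  by lia.
- move=> [nSF SF]; apply: xget_unique.
    split; first by move=> /zset_nat.
    case=> n nSn; last by [].
    have [//|ltFn] := leqP n F; case: nSn; exact/zset_nat/SF.
  move=> [n|n] [nSn maxn].
    have leF := maxn F%:Z (fun h => nSF (proj1 (zset_nat S F) h)).
    have [ltFn|ltnF|-> //] := ltngtP F n; last by lia.
    by case: nSn; apply/zset_nat/SF.
  have := maxn F%:Z (fun h => nSF (proj1 (zset_nat S F) h)).
  by lia.
Qed.

Lemma has_frobenius_numerical (F : nat) (S : set nat) :
  submonoid S -> has_frobenius F S -> numerical_semigroup S.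
Proof.
move=> mS [_ SF]; split=> //; apply: (sub_finite_set _ (finite_II F.+1)).
move=> n nSn /=; rewrite ltnS leqNgt; apply/negP => /SF; exact: nSn.
Qed.

Lemma in_upper_halfE (F : nat) (S : set nat) (x : nat) :
  frobenius S = F%:Z -> in_upper_half S x <-> (F < 2 * x)%N /\ (x < F)%N.
Proof.
move=> frobS; rewrite /in_upper_half frobS ltr_pdivrMr //.
rewrite -[2 in X in _ < X]/(2%:~R) -intrM ltr_int.
by split=> -[]; lia.
Qed.

(** * Atoms and the minimal system of generators *)

Definition atoms (S : set nat) : set nat :=
  [set a | [/\ S a, a <> 0%N &
    forall x y : nat, S x -> S y -> (x + y)%N = a -> x = 0%N \/ y = 0%N]].

Lemma gen_submonoid (A : set nat) : submonoid (gen A).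
Proof.
split=> [B /= mB|x y Ax Ay B /= mB]; first exact: mB.1.1.
by apply: mB.1.2; [apply: Ax|apply: Ay].
Qed.

(** Strong induction: a nonzero element that is not an atom splits into two smaller elements of
    [S]. *)
Lemma gen_atoms (S : set nat) : submonoid S -> gen (atoms S) = S.
Proof.
move=> mS; apply/seteqP; split; first by apply: smallest_sub => // x [].
have [g0 gD] := gen_submonoid (atoms S).
move=> n; have [m] := ubnP n; elim: m n => // m IHm n le_nm Sn.
have [->//|n_neq0] := eqVneq n 0%N.
have [An|nAn] := EM (atoms S n); first exact: sub_gen_smallest.
have [x [y [Sx Sy xyn x0 y0]]] :
    exists x y : nat, [/\ S x, S y, (x + y)%N = n, x <> 0%N & y <> 0%N].
  apply: contrapT => nex; apply: nAn; split=> // [|x y Sx Sy xyn].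
    exact/eqP.
  apply: contrapT => /not_orP [x0 y0]; apply: nex; by exists x, y.
by rewrite -xyn; apply: gD; apply: IHm => //; lia.
Qed.

(* [S] minus an atom is still a submonoid, so no generating set can omit it. *)
Lemma atoms_sub_gen (S A : set nat) : submonoid S -> gen A = S -> atoms S `<=` A.
Proof.
move=> [S0 SD] genA a [Sa a_neq0 atoma]; apply: contrapT => nAa.
suff /(_ a) : S `<=` S `\ a by move=> /(_ Sa) [_ []].
rewrite -{1}genA; apply: smallest_sub; last first.
  move=> x Ax; split; first by rewrite -genA; exact: sub_gen_smallest.
  by move=> xa; apply: nAa; rewrite -xa.
split; first by split=> // /esym.
move=> x y [Sx xa] [Sy ya]; split; first exact: SD.
move=> xya; have [x0|y0] := atoma _ _ Sx Sy xya.
  by apply: ya => /=; rewrite -xya x0.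
by apply: xa => /=; rewrite -xya y0 addn0.
Qed.

(** The atoms generate [S] and lie in every generating set, so no other generating set is
    minimal. *)
Lemma msgE (S : set nat) : submonoid S -> msg S = atoms S.
Proof.
move=> mS; apply: xget_unique.
  split; first exact: gen_atoms.
  by move=> B [BA nAB] /(atoms_sub_gen S B mS).
move=> A [genA minA]; apply: contrapT => nA.
have aA := atoms_sub_gen _ _ mS genA.
apply: (minA (atoms S)); last exact: gen_atoms.
by split=> // Aa; apply: nA; apply/seteqP.
Qed.

(** * Irreducibility as symmetry of the gaps *)

(** This covers symmetric semigroups ([F] odd) and pseudo-symmetric ones ([F] even), where the
    midpoint is exempt. *)
Definition gap_symmetric (F : nat) (S : set nat) : Prop :=
  forall x : nat, (x <= F)%N -> ~ S x -> (2 * x)%N <> F -> S (F - x)%N.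

(** Every numerical semigroup properly containing [S] contains [F]: a new element [x] gives [F] as
    [x + x] or as [x + (F - x)]. Hence so does any intersection of two of them. *)
Lemma symmetric_irreducible (F : nat) (S : set nat) :
  submonoid S -> has_frobenius F S -> gap_symmetric F S ->
  irreducible_semigroup S.
Proof.
move=> mS frobS symS; split; first exact: has_frobenius_numerical frobS.
case: frobS => nSF SF [S1 [S2 [nS1 nS2 SS1 SS2 S12]]].
have overF (T : set nat) : numerical_semigroup T -> S `<` T -> T F.
  move=> [[_ TD] _] [ST nTS].
  have [x Tx nSx] : exists2 x, T x & ~ S x.
    by apply: contrapT => nex; apply: nTS => x Tx; apply: contrapT => nSx;
       apply: nex; exists x.
  have leF : (x <= F)%N by rewrite leqNgt; apply/negP => /SF.
  have [<-|xF] := eqVneq (2 * x)%N F.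
    by rewrite mul2n -addnn; exact: TD.
  by rewrite -(subnKC leF); apply: TD => //; apply: ST; apply: symS => //; exact/eqP.
by apply: nSF; rewrite S12; split; apply: overF.
Qed.

Lemma submonoid_setU1 (S : set nat) (h : nat) :
  submonoid S -> S (h + h)%N ->
  (forall s, S s -> s <> 0%N -> S (h + s)%N) -> submonoid (h |` S).
Proof.
move=> [S0 SD] Shh Shs; split; first by right.
have hS s : S s -> (h |` S) (h + s)%N.
  by move=> Ss; have [->|/eqP s0] := eqVneq s 0%N; [left; rewrite addn0|right; exact: Shs].
move=> x y [->|Sx] [->|Sy]; first by right.
- exact: hS.
- by rewrite addnC; exact: hS.
- by right; exact: SD.
Qed.

(* If the symmetry fails, adjoining [F] on one side and the largest
   counterexample [h] on the other displays [S] as a proper intersection. *)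
Lemma irreducible_symmetric (F : nat) (S : set nat) :
  (0 < F)%N -> irreducible_semigroup S -> has_frobenius F S ->
  gap_symmetric F S.
Proof.
move=> F_gt0 [[mS _] irrS] frobS; have [nSF SF] := frobS; have [S0 SD] := mS.
pose bad x := `[< [/\ (x <= F)%N, ~ S x, (2 * x)%N <> F & ~ S (F - x)%N] >].
move=> x leF nSx xF; apply: contrapT => nSFx; apply: irrS.
have exbad : exists x, bad x by exists x; apply/asboolP.
have ubbad y : bad y -> (y <= F)%N by move=> /asboolP[].
have [h /asboolP[lehF nSh hF nSFh] maxh] := ex_maxnP exbad ubbad.
have ltFh : (F < 2 * h)%N.
  (* The mirror image of a counterexample is again one, so maximality puts [h] above F/2. *)
  have /maxh : bad (F - h)%N by apply/asboolP; split; rewrite ?subKn //; lia.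
  by lia.
have Sadd s : S s -> s <> 0%N -> S (h + s)%N.
  move=> Ss s0; apply: contrapT => nShs.
  have lehsF : (h + s <= F)%N by rewrite leqNgt; apply/negP => /SF.
  (* If [h + s] were a gap, it would be a larger counterexample. *)
  suff /maxh : bad (h + s)%N by lia.
  apply/asboolP; split=> //; first lia.
  move=> SFhs; apply: nSFh; have -> : (F - h = F - (h + s) + s)%N by lia.
  exact: SD.
have hNF : h <> F by move=> hE; apply: nSFh; rewrite hE subnn.
have numU y : submonoid (y |` S) -> numerical_semigroup (y |` S).
  split=> //; apply: (sub_finite_set _ (has_frobenius_numerical _ _ mS frobS).2).
  by move=> z /= nz Sz; apply: nz; right.
have properU y : ~ S y -> S `<` y |` S.
  by move=> nSy; split=> [z Sz|/(_ y) nsub]; [right|apply: nSy; apply: nsub; left].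
exists (F |` S), (h |` S); split; last first.
- apply/seteqP; split=> [y Sy|y [[->|//] [/esym //|//]]]; by split; right.
- exact: properU.
- exact: properU.
- by apply/numU/submonoid_setU1 => //; apply: SF; lia.
- by apply/numU/submonoid_setU1 => // [|s Ss s0]; apply: SF; lia.
Qed.

(** * Gaps of the second type, pseudo-Frobenius numbers and the type *)

Definition upper_second_gaps (F : nat) (S : set nat) : set nat :=
  [set x | [/\ ~ S x, ~ S (F - x)%N, (F < 2 * x)%N & (x < F)%N]].

Lemma second_gapsE (F : nat) (S : set nat) (x : nat) :
  S 0%N -> frobenius S = F%:Z -> has_frobenius F S ->
  second_gaps S x <-> [/\ ~ S x, ~ S (F - x)%N & (x < F)%N].
Proof.
move=> S0 frobS [nSF SF]; rewrite /second_gaps /= frobS; split.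
- move=> [nSx nSFx].
  have lexF : (x <= F)%N by rewrite leqNgt; apply/negP => /SF.
  rewrite (subzn lexF) zset_nat in nSFx; split=> //.
  (* [F] is not of the second type, since [F - F = 0] lies in [S]. *)
  rewrite ltn_neqAle lexF andbT; apply/eqP => xF.
  by apply: nSFx; rewrite xF subnn.
- by move=> [nSx nSFx ltxF]; rewrite (subzn (ltnW ltxF)) zset_nat.
Qed.

Lemma almost_symmetricP (F : nat) (S : set nat) :
  (0 < F)%N -> numerical_semigroup S -> has_frobenius F S ->
  almost_symmetric S <->
  (forall x s : nat, ~ S x -> ~ S (F - x)%N -> (x < F)%N ->
     S s -> s <> 0%N -> S (x + s)%N).
Proof.
move=> F_gt0 nS frobS; have [[S0 SD] _] := nS.
have frobSE := (frobeniusP _ S F_gt0).2 frobS.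
split=> [[_ LPF] x s nSx nSFx ltxF Ss s0|addS].
  have /LPF [_ /(_ s Ss s0)] : zset (second_gaps S) x%:Z.
    by apply/zset_nat/(second_gapsE F).
  by move=> /zset_nat.
split=> // z [x /(second_gapsE _ _ _ S0 frobSE frobS)[nSx nSFx ltxF] <-].
split; first by rewrite zset_nat.
by move=> s Ss s0; apply/zset_nat; exact: addS.
Qed.

(* Negative pseudo-Frobenius numbers are excluded by adding [F - z > F]. *)
Lemma pseudo_frobeniusE (F : nat) (S : set nat) :
  (0 < F)%N -> almost_symmetric S -> has_frobenius F S ->
  pseudo_frobenius S =
    zset [set x | x = F \/ [/\ ~ S x, ~ S (F - x)%N & (x < F)%N]].
Proof.
move=> F_gt0 asS frobS; have [nS _] := asS; have [[S0 SD] _] := nS.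
have /(almost_symmetricP _ _ F_gt0 nS frobS) addS := asS.
have [nSF SF] := frobS.
apply/seteqP; split=> z; last first.
  move=> [x + <-] => -[->|[nSx nSFx ltxF]]; (split; first by rewrite zset_nat)
    => s Ss s0; apply/zset_nat.
    by apply: SF; lia.
  exact: addS.
move=> [nSz addz].
(* Used twice: to rule out negative [z], and to show that [F - z] is a gap when [0 <= z < F]. *)
have gapF (n : nat) : S n -> n <> 0%N -> z + n%:Z = F%:Z -> False.
  by move=> Sn n0 znF; apply: nSF; have := addz n Sn n0; rewrite znF zset_nat.
case: z nSz addz gapF => [x|x] nSx addx gapF; last first.
  by exfalso; apply: (gapF (F + x.+1)%N); [apply: SF; lia|lia|lia].
rewrite zset_nat in nSx; apply/zset_nat.
have lexF : (x <= F)%N by rewrite leqNgt; apply/negP => /SF.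
have [->|xF] := eqVneq x F; first by left.
right; split=> //; last by lia.
by move=> SFx; apply: (gapF (F - x)%N) => //; lia.
Qed.

Lemma cardfsU_disjoint (K : choiceType) (A B : {fset K}) :
  (forall x, x \in A -> x \in B -> False) ->
  #|` A `|` B|%fset = (#|` A| + #|` B|)%N.
Proof.
move=> disj; rewrite cardfsU (_ : (A `&` B = fset0)%fset) ?cardfs0 ?subn0 //.
apply/fsetP => x; rewrite !inE; apply/negP => /andP[]; exact: disj.
Qed.

(** The set splits into the upper gaps, their mirror images [V], the midpoint [M] (present only for
    even [F]) and [F] itself; positions relative to F/2 and [F] make the pieces disjoint. *)
Lemma semigroup_type_upper (F : nat) (S : set nat) :
  (0 < F)%N -> almost_symmetric S -> has_frobenius F S ->
  semigroup_type S =
    (2 * #|` fset_set (upper_second_gaps F S)| + ~~ odd F + 1)%N.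
Proof.
move=> F_gt0 asS frobS; have [[[S0 SD] _] _] := asS; have [nSF SF] := frobS.
set U := upper_second_gaps F S.
have finU : finite_set U.
  by apply: (sub_finite_set _ (finite_II F)) => x [].
have UP x : x \in fset_set U ->
    [/\ ~ S x, ~ S (F - x)%N, (F < 2 * x)%N & (x < F)%N].
  by rewrite in_fset_set // inE.
have U_upper x : x \in fset_set U -> (F < 2 * x)%N /\ (x < F)%N by case/UP.
pose V := [fset (F - x)%N | x in fset_set U]%fset.
pose M := (if odd F then fset0 else [fset F./2])%fset.
have MP x : x \in M -> (2 * x)%N = F.
  by rewrite /M; case: ifPn => oF; rewrite !inE // => /eqP ->; lia.
have VP x : x \in V -> (2 * x < F)%N /\ (x < F)%N.
  by move=> /imfsetP[y /= /U_upper ? ->]; lia.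
rewrite /semigroup_type (pseudo_frobeniusE F) //.
rewrite (_ : [set x | _] = [set` fset_set U `|` V `|` M `|` [fset F]]%fset).
  rewrite /zset fset_set_image ?finite_fset // card_imfset /=; last by move=> ? ? [].
  rewrite set_fsetK cardfsU_disjoint; last first.
    by move=> x; rewrite !in_fsetU !in_fset1 => /orP[/orP[/U_upper|/VP]|/MP] ? /eqP; lia.
  rewrite cardfsU_disjoint; last first.
    by move=> x; rewrite !in_fsetU => /orP[/U_upper|/VP] ? /MP; lia.
  rewrite cardfsU_disjoint; last by move=> x /U_upper ? /VP; lia.
  rewrite cardfs1 card_in_imfset /=; last first.
    by move=> x y /U_upper ? /U_upper ?; lia.
  have -> : #|` M| = ~~ odd F by rewrite /M; case: odd; rewrite ?cardfs0 ?cardfs1.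
  lia.
apply/seteqP; split=> x /=; rewrite !inE.
  move=> [->|[nSx nSFx ltxF]]; first by rewrite eqxx !orbT.
  have x0 : x <> 0%N by move=> x0; apply: nSx; rewrite x0.
  have [ltF2x|lt2xF|eqF] := ltngtP F (2 * x)%N.
  - by rewrite in_fset_set // mem_set.
  - suff -> : x \in V by rewrite !orbT.
    apply/imfsetP; exists (F - x)%N; last by rewrite subKn // ltnW.
    rewrite /= in_fset_set // inE; split; rewrite ?subKn ?(ltnW ltxF) //; lia.
  - suff -> : x \in M by rewrite !orbT.
    by rewrite /M eqF oddM /= in_fset1 mul2n doubleK.
move=> /orP[/orP[/orP[/UP[]|/imfsetP[y /= /UP[nSy nSFy ltFy ltyF] ->]]|/MP xF]|/eqP].
- by right.
- by right; split; rewrite ?(subKn (ltnW ltyF)) //; lia.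
(* The midpoint is a gap because its double is [F], and it is its own mirror image. *)
- have nSx : ~ S x by move=> Sx; apply: nSF; rewrite -xF mul2n -addnn; exact: SD.
  right; split=> //; last by lia.
  by have -> : (F - x)%N = x by lia.
- by left.
Qed.

Lemma finite_card_eqP (T : choiceType) (A : set T) (n : nat) :
  finite_set A -> #|` fset_set A| = n <-> (A #= `I_n)%card.
Proof.
move=> finA; split=> [cA|/card_fset_set //].
by rewrite -(fset_setK finA); apply/card_eq_fsetP.
Qed.

(** As [F] and [t] have the same parity, solving [2 * u + ~~ odd F + 1 = t] gives
    [u = (uphalf t).-1]; positivity of [t] keeps the predecessor from truncating. *)
Lemma semigroup_typeP (F t : nat) (S : set nat) :
  (0 < F)%N -> (0 < t)%N -> ~~ odd (F + t) ->
  almost_symmetric S -> has_frobenius F S ->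
  semigroup_type S = t <-> (upper_second_gaps F S #= `I_(uphalf t).-1)%card.
Proof.
move=> F_gt0 t_gt0 Ft_even asS frobS; rewrite -finite_card_eqP; last first.
  by apply: (sub_finite_set _ (finite_II F)) => x [].
rewrite (semigroup_type_upper F) //; split; lia.
Qed.

(** * Adjoining the upper second-type gaps *)

(** Any sum of two nonzero elements of the union falls in [S]: by almost symmetry if one is in [S],
    and by exceeding [F] if both are new. This gives closure and makes the new elements atoms.
    Symmetry holds because the larger of two paired gaps is adjoined. *)
Lemma almost_symmetric_setU (F : nat) (S : set nat) :
  (0 < F)%N -> almost_symmetric S -> has_frobenius F S ->
  [/\ submonoid (S `|` upper_second_gaps F S),
      has_frobenius F (S `|` upper_second_gaps F S),
      gap_symmetric F (S `|` upper_second_gaps F S) &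
      upper_second_gaps F S `<=` atoms (S `|` upper_second_gaps F S)].
Proof.
move=> F_gt0 asS frobS; have [nS _] := asS; have [[S0 SD] _] := nS.
have /(almost_symmetricP _ _ F_gt0 nS frobS) addS := asS.
have [nSF SF] := frobS; set U := upper_second_gaps F S.
have addU u s : U u -> S s -> s <> 0%N -> S (u + s)%N.
  by move=> [? ? _ ?]; exact: addS.
have addUU u v : U u -> U v -> S (u + v)%N.
  by move=> [_ _ ? _] [_ _ ? _]; apply: SF; lia.
split.
- split; first by left.
  have addU' u s : U u -> S s -> (S `|` U) (u + s)%N.
    move=> Uu Ss; have [->|/eqP s0] := eqVneq s 0%N; first by right; rewrite addn0.
    by left; exact: addU.
  move=> x y [Sx|Ux] [Sy|Uy].
  + by left; exact: SD.
  + by rewrite addnC; exact: addU'.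
  + exact: addU'.
  + by left; exact: addUU.
- split; last by move=> n /SF; left.
  by move=> [//|[_ _ _]]; rewrite ltnn.
- move=> x lexF nx x2F; apply: contrapT => nFx.
  have nSx : ~ S x by move=> Sx; apply: nx; left.
  have nSFx : ~ S (F - x)%N by move=> ?; apply: nFx; left.
  have xF : x <> F by move=> xF; apply: nSFx; rewrite xF subnn.
  have x0 : x <> 0%N by move=> x0; apply: nSx; rewrite x0.
  have [ltF2x|lt2xF|eqF] := ltngtP F (2 * x)%N; last by lia.
    by apply: nx; right; split=> //; lia.
  by apply: nFx; right; split; rewrite ?subKn //; lia.
- move=> a Ua; have [nSa nSFa ltFa ltaF] := Ua; split; [by right|lia|].
  move=> x y Sx Sy xya; apply: contrapT => /not_orP [x0 y0]; apply: nSa.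
  rewrite -xya; case: Sx Sy => [Sx|Ux] [Sy|Uy].
  + exact: SD.
  + by rewrite addnC; exact: addU.
  + exact: addU.
  + exact: addUU.
Qed.

(** * Removing atoms that lie above F/2 *)

Section RemoveAtoms.
Variables (F : nat) (T A : set nat).
Hypotheses (F_gt0 : (0 < F)%N) (mT : submonoid T) (frobT : has_frobenius F T)
  (symT : gap_symmetric F T) (A_atoms : A `<=` atoms T)
  (A_upper : forall x, A x -> (F < 2 * x)%N /\ (x < F)%N)
  (A_sum : forall x y, A x -> A y -> ~ (T `\` A) (x + y - F)%N).

Let T_half (x : nat) : (2 * x)%N = F -> ~ T x.
Proof.
move=> xF Tx; apply: frobT.1; rewrite -xF mul2n -addnn; exact: mT.2.
Qed.

Let T_compl (x : nat) : (x <= F)%N -> T x -> ~ T (F - x)%N.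
Proof.
by move=> lexF Tx TFx; apply: frobT.1; rewrite -(subnKC lexF); exact: mT.2.
Qed.

Lemma setD_has_frobenius : has_frobenius F (T `\` A).
Proof.
split=> [[TF _]|n ltFn]; first exact: frobT.1.
by split=> [|/A_upper]; [exact: frobT.2|lia].
Qed.

Lemma setD_second_gaps (x : nat) :
  ~ (T `\` A) x -> ~ (T `\` A) (F - x)%N -> (x < F)%N ->
  [\/ A x, A (F - x)%N | (2 * x)%N = F].
Proof.
move=> nx nFx ltxF; have [Ax|nAx] := EM (A x); first exact: Or31.
have nTx : ~ T x by move=> Tx; apply: nx.
have [/Or33 //|/eqP xF] := eqVneq (2 * x)%N F.
apply: Or32; apply: contrapT => nAFx; apply: nFx; split=> //.
by apply: symT => //; exact: ltnW.
Qed.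

(** Mirror images of elements of [A] lie below F/2, which leaves only [A x]. Conversely [T] cannot
    contain both [x] and [F - x], whose sum is [F]. *)
Lemma setD_upper_second_gaps : upper_second_gaps F (T `\` A) = A.
Proof.
apply/seteqP; split=> x.
  move=> [nx nFx ltFx ltxF]; have [//|/A_upper|] := setD_second_gaps x nx nFx ltxF; lia.
move=> Ax; have [ltFx ltxF] := A_upper x Ax; split=> //; first by move=> [].
by move=> [TFx _]; apply: T_compl TFx; [exact: ltnW|case: (A_atoms _ Ax)].
Qed.

Lemma setD_almost_symmetric :
  numerical_semigroup (T `\` A) -> almost_symmetric (T `\` A).
Proof.
move=> nS; apply/(almost_symmetricP F) => //; first exact: setD_has_frobenius.
move=> x s nx nFx ltxF [Ts nAs] s0; have [[_ SD] _] := nS.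
have [Ax|AFx|xF] := setD_second_gaps x nx nFx ltxF.
(* The sum [x + s] stays in [T] and, being decomposable, is not one of the removed atoms. *)
- have [Tx x0 _] := A_atoms _ Ax; split; first exact: mT.2.
  by move=> /A_atoms [_ _ /(_ x s Tx Ts erefl)] [].
- apply: contrapT => nxs; have [TFx _ atomFx] := A_atoms _ AFx.
  have [Axs|nAxs] := EM (A (x + s)%N).
    apply: (A_sum _ _ Axs AFx).
    by have -> : (x + s + (F - x) - F = s)%N by lia.
  have nTxs : ~ T (x + s)%N by move=> ?; apply: nxs.
  have lexsF : (x + s <= F)%N by rewrite leqNgt; apply/negP => /frobT.2.
  have [xsF|/eqP xsF] := eqVneq (2 * (x + s))%N F.
    (* Here [F = 2 * (x + s)], so doubling [F - x] exceeds [F] by exactly [s + s]. *)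
    apply: (A_sum _ _ AFx AFx).
    have -> : (F - x + (F - x) - F = s + s)%N by lia.
    exact: SD.
  have Tr := symT _ lexsF nTxs xsF.
  (* The atom [F - x] is the sum of [s] and [F - (x + s)], both in [T]; the second must vanish,
     which would put [s] in [A]. *)
  have [//|r0] : s = 0%N \/ (F - (x + s))%N = 0%N.
    by apply: atomFx => //; lia.
  by apply: nAs; have -> : s = (F - x)%N by lia.
- split; last first.
    move=> Axs; apply: (A_sum _ _ Axs Axs).
    have -> : (x + s + (x + s) - F = s + s)%N by lia.
    exact: SD.
  apply: contrapT => nTxs.
  have lexsF : (x + s <= F)%N by rewrite leqNgt; apply/negP => /frobT.2.
  have Tr : T (F - (x + s))%N by apply: symT => //; lia.
  (* Otherwise the midpoint [x] would be a sum of two elements of [T]. *)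
  apply: (T_half x xF).
  have -> : x = (F - (x + s) + s)%N by lia.
  exact: mT.2.
Qed.

End RemoveAtoms.

Theorem theorem11 (F t : nat) (S : set nat)
    (F_gt0 : (0 < F)%N) (t_gt0 : (0 < t)%N)
    (Ft_even : ~~ odd (F + t)) (Ft_le : (F + t <= 2 * F)%N)
    (nsS : numerical_semigroup S) :
  [/\ almost_symmetric S, frobenius S = F%:Z & semigroup_type S = t] <->
  exists S' : set nat, scrB F t S' /\
    exists A : set nat,
      [/\ A `<=` msg S',
          (A #= `I_(uphalf t).-1)%card,
          S = S' `\` A,
          (forall x : nat, A x -> in_upper_half S' x) &
          (forall x y : nat, A x -> A y ->
             ~ zset (S' `\` A) (x%:Z + y%:Z - frobenius S'))].
Proof.
split.
- move=> [asS /(frobeniusP _ _ F_gt0) frobS typeS].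
  set U := upper_second_gaps F S.
  have cardU : (U #= `I_(uphalf t).-1)%card by apply/semigroup_typeP.
  have [mS' frobS' symS' atomsU] := almost_symmetric_setU _ _ F_gt0 asS frobS.
  rewrite -/U in mS' frobS' symS' atomsU.
  have frobS'E := (frobeniusP _ _ F_gt0).2 frobS'.
  have SE : S = (S `|` U) `\` U.
    by apply/seteqP; split=> [x Sx|x [[]]//]; split; [left|case].
  have upU x : U x -> in_upper_half (S `|` U) x.
    by case=> _ _ ? ?; apply/(in_upper_halfE F).
  exists (S `|` U); split; last first.
    exists U; split=> //; first by rewrite msgE.
    move=> x y Ux Uy; rewrite -SE frobS'E.
    have [nSx nSFx ltFx ltxF] := Ux; have [nSy nSFy ltFy ltyF] := Uy.
    (* Both [x] and [y] exceed F/2, so the truncated subtraction is exact. *)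
    have -> : x%:Z + y%:Z - F%:Z = (x + y - F)%N%:Z by lia.
    rewrite zset_nat => Sxy; apply: nSx.
    (* [F - y] is a second-type gap, so adding the nonzero element [x + y - F] of [S] to it would
       put [x] in [S]. *)
    have -> : x = (F - y + (x + y - F))%N by lia.
    have /(almost_symmetricP _ _ F_gt0 nsS frobS) addS := asS.
    by apply: addS; rewrite ?(subKn (ltnW ltyF)) //; lia.
  split; first by split=> //; exact: (symmetric_irreducible F).
  (* The set counted by [b] contains [U], whose cardinality is the required bound. *)
  rewrite /b -(card_fset_set cardU).
  have finU : finite_set U by exists (uphalf t).-1.
  have finB : finite_set [set x | msg (S `|` U) x /\ in_upper_half (S `|` U) x].
    apply: (sub_finite_set _ (finite_II F)) => x [_].
    by move=> /(in_upper_halfE _ _ _ frobS'E)[].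
  apply: fsubset_leq_card; rewrite -fset_set_sub // => x Ux.
  by split; [rewrite msgE //; exact: atomsU|exact: upU].
- move=> [T [[[irrT frobTE] _] [A [+ cardA SE upA sumA]]]].
  have [[mT _] _] := irrT; rewrite msgE // => atomsA.
  have frobT := (frobeniusP _ _ F_gt0).1 frobTE.
  have symT := irreducible_symmetric _ _ F_gt0 irrT frobT.
  have upper x : A x -> (F < 2 * x)%N /\ (x < F)%N.
    by move=> /upA /(in_upper_halfE _ _ _ frobTE).
  have sums x y : A x -> A y -> ~ (T `\` A) (x + y - F)%N.
    move=> Ax Ay; have [ltFx _] := upper x Ax; have [ltFy _] := upper y Ay.
    have := sumA x y Ax Ay; rewrite frobTE.
    have -> : x%:Z + y%:Z - F%:Z = (x + y - F)%N%:Z by lia.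
    by rewrite zset_nat.
  rewrite SE in nsS *.
  have frobS : has_frobenius F (T `\` A) by exact: setD_has_frobenius.
  have asS : almost_symmetric (T `\` A) by exact: (setD_almost_symmetric F).
  split=> //; first exact/frobeniusP.
  by apply/(semigroup_typeP F) => //; rewrite setD_upper_second_gaps.
Qed.
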